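(* For every uncountable range set $R$, every $R$-petaloid ultrametric space is compactly ultrahomogeneous. Consequently, it is ultrahomogeneous.
   Context: A metric space $(X,d)$ is ultrahomogeneous (resp. compactly ultrahomogeneous) if for every finite subset (resp. compact subset) $A$ of $X$ and every isometric embedding $\phi:A\to X$ there exists an isometric bijection $F:X\to X$ with $F|_A=\phi$. A range set is a subset $R\subseteq[0,\infty)$ with $0\in R$. An ultrametric is a metric $d$ with $d(x,y)\le \max\{d(x,z),d(z,y)\}$ for all $x,y,z$. An ultrametric $d$ on a set $X$ is $R$-valued (an $R$-ultrametric) if $d(x,y)\in R$ for all $x,y\in X$. A subset $E\subseteq[0,\infty)$ is semi-sporadic if there is a strictly decreasing sequence $\{a_i\}_{i\in\mathbb{Z}_{\ge 0}}$ in $(0,\infty)$ with $\lim_{i\to\infty} a_i=0$ and $E=\{0\}\cup\{a_i\mid i\in\mathbb{Z}_{\ge0}\}$. A subset of $[0,\infty)$ is tenuous if it is finite or semi-sporadic. $\mathrm{TEN}(R)$ denotes the set of all tenuous subsets $S\subseteq R$ with $0\in S$. For a metric space $(X,d)$, $x\in X$ and $A\subseteq X$, put $d(x,A)=\inf_{a\in A}d(x,a)$; restrictions of a metric to subsets are denoted by the same symbol. For a range set $S$, $\mathscr{N}(S)$ is the class of all finite $S$-valued ultrametric spaces. For a class $\mathscr{C}$ of metric spaces, a metric space $(X,d)$ is $\mathscr{C}$-injective if for all $(A,a),(B,b)\in\mathscr{C}$ and all isometric embeddings $\phi:(A,a)\to(B,b)$, $\psi:(A,a)\to(X,d)$ there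 is an isometric embedding $\theta:(B,b)\to(X,d)$ with $\theta\circ\phi=\psi$. For a countable (possibly finite) range set $S$, the $S$-Urysohn universal ultrametric space is the non-empty separable complete $\mathscr{N}(S)$-injective $S$-valued ultrametric space, which is unique up to isometry. For an uncountable range set $R$, a metric space $(X,d)$ is $R$-petaloid if it is an $R$-valued ultrametric space and there is a family $\{\Pi(X,S)\}_{S\in\mathrm{TEN}(R)}$ of subspaces of $X$ (called an $R$-petal of $X$) such that: (P1) for every $S\in\mathrm{TEN}(R)$, $(\Pi(X,S),d)$ is isometric to the $S$-Urysohn universal ultrametric space; (P2) $\bigcup_{S\in\mathrm{TEN}(R)}\Pi(X,S)=X$; (P3) $\Pi(X,S)\cap\Pi(X,T)=\Pi(X,S\cap T)$ for all $S,T\in\mathrm{TEN}(R)$; (P4) if $S,T\in\mathrm{TEN}(R)$ and $x\in\Pi(X,T)$, then $d(x,\Pi(X,S))\in(T\setminus S)\cup\{0\}$. *)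

(* Defs.v *)
From HB Require Import structures.
From mathcomp Require Import all_boot all_order all_algebra.
From mathcomp Require Import all_classical all_reals all_analysis.

Set Implicit Arguments.
Unset Strict Implicit.
Unset Printing Implicit Defensive.

Import Order.TTheory GRing.Theory Num.Theory.
Import numFieldNormedType.Exports.

Local Open Scope classical_set_scope.
Local Open Scope ring_scope.

(* The library puts the induced pseudometric on the subtype of a set
   [A : set X]; the following makes it a metric space, with the restricted
   distance. *)
Section subtype_metric.
Context {K : realType} {X : metricType K} (A : set X).

Let dist (x y : A) : K := mdist (\val x) (\val y).

Let dist_ge0 x y : 0 <= dist x y.
Proof. exact: mdist_ge0. Qed.

Let dist_positivity x y : dist x y = 0 -> x = y.
Proof. by move=> /mdist_positivity /val_inj. Qed.

Let ballEdist (x : A) e : ball x e = [set y | dist x y < e].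
Proof.
by rewrite -(initial_ballE (f := set_val)) ballEmdist set_valE.
Qed.

HB.instance Definition _ := @PseudoMetric_isMetric.Build K (set_type A)
  dist dist_ge0 dist_positivity ballEdist.

End subtype_metric.

Definition isometric_embedding (K : realType) (X Y : metricType K)
    (f : X -> Y) : Prop :=
  forall x y, mdist (f x) (f y) = mdist x y.

Definition isometric_bijection (K : realType) (X Y : metricType K)
    (f : X -> Y) : Prop :=
  isometric_embedding f /\ bijective f.

Definition isometric (K : realType) (X Y : metricType K) : Prop :=
  exists f : X -> Y, isometric_bijection f.

Definition extends_isometries (K : realType) (X : metricType K)
    (A : set X) : Prop :=
  forall phi : A -> X, isometric_embedding phi ->
    exists F : X -> X, isometric_bijection F /\ (forall a : A, F (\val a) = phi a).

Definition ultrahomogeneous (K : realType) (X : metricType K) : Prop :=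
  forall A : set X, finite_set A -> extends_isometries A.

Definition compactly_ultrahomogeneous (K : realType) (X : metricType K) : Prop :=
  forall A : set X, compact A -> extends_isometries A.

Definition range_set (K : realType) (R : set K) : Prop :=
  R `<=` [set x | 0 <= x] /\ R 0.

Definition ultrametric (K : realType) (X : metricType K) : Prop :=
  forall x y z : X, mdist x y <= Num.max (mdist x z) (mdist z y).

Definition valued (K : realType) (R : set K) (X : metricType K) : Prop :=
  forall x y : X, R (mdist x y).

Definition valued_ultrametric (K : realType) (R : set K) (X : metricType K) : Prop :=
  ultrametric X /\ valued R X.

Definition semi_sporadic (K : realType) (E : set K) : Prop :=
  exists a : nat -> K,
    [/\ forall i, 0 < a i,
        decreasing_seq a,
        a i @[i --> \oo] --> 0
      & E = [set 0] `|` range a].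

Definition tenuous (K : realType) (E : set K) : Prop :=
  E `<=` [set x | 0 <= x] /\ (finite_set E \/ semi_sporadic E).

Definition TEN (K : realType) (R : set K) : set (set K) :=
  [set S | [/\ S `<=` R, tenuous S & S 0]].

Definition dist_to_set (K : realType) (X : metricType K) (x : X) (A : set X) : K :=
  inf [set mdist x a | a in A].

Definition finite_valued_ultrametric (K : realType) (S : set K)
    (X : metricType K) : Prop :=
  finite_set [set: X] /\ valued_ultrametric S X.

Definition class_injective (K : realType) (C : metricType K -> Prop)
    (X : metricType K) : Prop :=
  forall A B : metricType K, C A -> C B ->
  forall (phi : A -> B) (psi : A -> X),
    isometric_embedding phi -> isometric_embedding psi ->
    exists theta : B -> X, isometric_embedding theta /\ theta \o phi = psi.

Definition separable (K : realType) (X : metricType K) : Prop :=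
  exists D : set X, countable D /\ dense D.

(* The library's [completeType] is restricted to pointed types, hence the
   unfolded form of its axiom. *)
Definition complete (K : realType) (X : metricType K) : Prop :=
  forall F : set_system X, ProperFilter F -> cauchy F -> exists x : X, F --> x.

(* [urysohn S U]: U is the S-Urysohn universal ultrametric space (S a countable
   range set), which is unique only up to isometry. *)
Definition urysohn (K : realType) (S : set K) (U : metricType K) : Prop :=
  [/\ [set: U] !=set0,
      separable U,
      complete U,
      class_injective (finite_valued_ultrametric S) U
    & valued_ultrametric S U].

(* The petal is a function on all subsets of K, but only its values on TEN R
   are constrained; TEN R is closed under intersection. *)
Definition petal (K : realType) (R : set K) (X : metricType K)
    (Pi : set K -> set X) : Prop :=
  [/\ forall S, TEN R S ->
        exists2 U : metricType K, urysohn S U & isometric (set_type (Pi S)) U,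
      \bigcup_(S in TEN R) Pi S = [set: X],
      forall S T, TEN R S -> TEN R T -> Pi S `&` Pi T = Pi (S `&` T)
    & forall S T x, TEN R S -> TEN R T -> Pi T x ->
        ((T `\` S) `|` [set 0]) (dist_to_set x (Pi S))].

Definition petaloid (K : realType) (R : set K) (X : metricType K) : Prop :=
  valued_ultrametric R X /\ exists Pi : set K -> set X, petal R Pi.

(* Main.v *)
From HB Require Import structures.
Require Import Defs.
From mathcomp Require Import all_boot all_order all_algebra.
From mathcomp Require Import all_classical all_reals all_analysis.

Set Implicit Arguments.
Unset Strict Implicit.
Unset Printing Implicit Defensive.

Import Order.TTheory GRing.Theory Num.Theory.
Import numFieldNormedType.Exports.

Local Open Scope classical_set_scope.
Local Open Scope ring_scope.

(** The model of a petaloid space is the set of functions f on the positive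
    elements of R with values in nat whose support is tenuous, where d(f, g) is
    the largest t with f(t) <> g(t). The proof gives X such coordinates and then
    writes down the extension of an isometry coordinatewise.

    Coordinates. Each closed ball of radius r > 0 contains exactly one center: a
    point of a piece Pi S with S finite and all positive elements of S above r
    (petal_center, center_unique). The open r-balls in a closed r-ball can be
    numbered by nat, with number 0 for the ball of the center
    (child_numbering): separability bounds their number, injectivity makes it
    infinite. The coordinate of x at r is the number of its open r-ball. Two
    points at distance t have equal coordinates above t and different ones at t.
    A point of Pi T has coordinates supported in T (petal_support), and
    conversely every function supported in a tenuous T comes from a point
    (realise), by successive choices of balls for finite supports and by
    completeness of Pi T in general. Hence coordinates of different points may
    be concatenated at any scale (coordinate_system).

    Extension. Let phi be an isometric embedding of a compact set A. In a closed
    ball of radius t centered in A, compactness leaves finitely many coordinates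
    at t among the points of A, so phi induces a finite partial injection of nat
    that extends to a permutation (ball_bijections). Given x, let a be a nearest
    point of A and r = d(x, a). The image of x has the coordinates of phi a
    above r, the permuted coordinate of x at r, and the coordinates of x below
    r. At each scale the rule is injective and the same for all points of a
    closed ball, so distances are preserved (matched_isometric); the inverse
    permutations give the inverse map (matched_inverse). Finite sets are
    compact, which gives ultrahomogeneity. *)

(** * Permutations of the naturals and locally finite sets of reals *)

(** Each new pair (m, n) is accommodated by composing the permutation found so
    far with one transposition, which moves none of the values already
    prescribed because the pairs form a partial injection. *)
Lemma permutation_extending (s : seq (nat * nat)) :
  {in s &, forall u v, u.1 = v.1 <-> u.2 = v.2} ->
  exists f : nat -> nat, bijective f /\ {in s, forall u, f u.1 = u.2}.
Proof.
elim: s => [|[m n] s IH] hs; first by exists id; split=> //; exists id.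
have [u v us vs|f [bf fE]] := IH.
  by apply: hs; rewrite inE ?us ?vs orbT.
pose swap k := if k == f m then n else if k == n then f m else k.
have swapK : involutive swap.
  move=> k; rewrite /swap.
  case: (k =P f m) => [->|kf]; last case: (k =P n) => [->|kn].
  - by rewrite eqxx; case: eqP => // ->.
  - by rewrite eqxx.
  - by move/eqP: kf => /negPf->; move/eqP: kn => /negPf->.
exists (swap \o f); split.
  by apply: bij_comp bf; exists swap.
move=> [i j]; rewrite inE => /orP[/eqP[-> ->]|ijs] /=.
  by rewrite /swap eqxx.
have := hs (i, j) (m, n); rewrite !inE eqxx ijs orbT => /(_ isT isT) /= ij.
have fi := fE _ ijs; rewrite /= in fi.
rewrite /swap fi; case: (j =P f m) => [jf|jf].
  by apply/esym/ij.1; apply: (bij_inj bf); rewrite fi.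
by case: (j =P n) => // jn; case: jf; rewrite -fi (ij.2 jn).
Qed.

Section real_sets.
Context {K : realType}.
Implicit Types (A T : set K).

Lemma finite_set_min A : finite_set A -> A !=set0 ->
  exists2 m, A m & forall a, A a -> m <= a.
Proof.
move=> /finite_seqP[s ->]; elim: s => [[x]//|b s IH] _.
have [[y ys]|/nonemptyPn s0] := pselect ([set` s] !=set0); last first.
  exists b => /=; first by rewrite inE eqxx.
  move=> a; rewrite inE => /orP[/eqP->//|as'].
  by have : [set` s] a by []; rewrite s0.
have [|m ms mP] := IH; first by exists y.
have [bm|mb] := leP b m.
  exists b => /=; first by rewrite inE eqxx.
  move=> a; rewrite inE => /orP[/eqP->//|/mP]; exact: le_trans.
exists m => /=; first by rewrite inE ms orbT.
by move=> a; rewrite inE => /orP[/eqP->|/mP//]; exact: ltW.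
Qed.

Lemma finite_set_max A : finite_set A -> A !=set0 ->
  exists2 m, A m & forall a, A a -> a <= m.
Proof.
move=> fA [a Aa].
have [|| _ [m Am <-] mP] := @finite_set_min (-%R @` A).
- exact: finite_image.
- by exists (- a), a.
by exists m => // b Ab; rewrite -lerN2; apply: mP; exists b.
Qed.

(** The only possible accumulation point is 0. Unlike an enumeration, this form
    passes at once to subsets and to finite unions. *)
Definition locally_finite_pos T := forall e, 0 < e -> finite_set (T `&` [set t | e <= t]).

Lemma tenuous_locally_finite T : tenuous T -> locally_finite_pos T.
Proof.
move=> [_ [fT e _|[a [a0 adec acvg ->]] e e0]].
  exact: sub_finite_set fT.
have [N _ aN] : \forall n \near \oo, a n < e.
  have /cvgrPdist_lt/(_ _ e0) := acvg; apply: filterS => n.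
  by rewrite sub0r normrN; apply: le_lt_trans; exact: ler_norm.
apply: (@sub_finite_set _ _ (a @` `I_N)); last exact/finite_image/finite_II.
move=> _ [[/= ->|[n _ <-]]]; first by rewrite leNgt e0.
rewrite /= => ean; exists n => //=; rewrite ltnNge; apply/negP => Nn.
by have := aN n Nn; rewrite /= ltNge ean.
Qed.

(** An infinite such set is listed in decreasing order: below each positive
    level there is a largest element, since only finitely many lie above any
    given one of them. *)
Lemma locally_finite_tenuous T : T 0 -> T `<=` [set x | 0 <= x] ->
  locally_finite_pos T -> tenuous T.
Proof.
move=> T0 Tpos Tfin; split=> //.
have [fT|iT] := pselect (finite_set T); [by left|right].
have nextP s : exists u, 0 < s ->
    [/\ T u, 0 < u, u < s & forall v, T v -> v < s -> v <= u].
  have [s0|] := ltP 0 s; last by exists 0.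
  pose B := T `&` [set t | 0 < t < s].
  have [[u [Tu /andP[u0 us]]]|/nonemptyPn B0] := pselect (B !=set0).
    have [|| m [[Tm um] ms] mP] :=
        @finite_set_max ((T `&` [set t | u <= t]) `&` [set t | t < s]).
    - by apply: sub_finite_set (Tfin _ u0) => x [].
    - by exists u; split=> //; split=> //=.
    exists m => _; split=> // [|v Tv vs]; first exact: lt_le_trans um.
    have [uv|/ltW vu] := leP u v; first by apply: mP.
    exact: le_trans vu um.
  case: iT; apply: (@sub_finite_set _ _ ([set 0] `|` (T `&` [set t | s <= t]))).
    move=> t Tt; have [st|ts] := leP s t; [by right|left].
    have := Tpos _ Tt; rewrite /= le_eqVlt => /orP[/eqP<-//|t0].
    by have : B t by [split=> //=; rewrite t0]; rewrite B0.
  by rewrite finite_setU; split; [exact: finite_set1|exact: Tfin].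
have [next nP] := choice nextP.
have [|| M _ MP] := @finite_set_max ([set 0] `|` (T `&` [set t | 1 <= t])).
- by rewrite finite_setU; split; [exact: finite_set1|exact: Tfin].
- by exists 0; left.
have M0 : 0 <= M by apply: MP; left.
pose a n := iter n.+1 next (M + 1).
have a_gt0 n : 0 < a n.
  by elim: n => [|n an]; [case: (nP _ (ltr_wpDl M0 ltr01))|case: (nP _ an)].
have aT n : T (a n).
  case: n => [|n]; first by case: (nP _ (ltr_wpDl M0 ltr01)).
  by case: (nP _ (a_gt0 n)).
have adec : decreasing_seq a.
  apply/decreasing_seqP => n.
  by case: (nP _ (a_gt0 n)).
have a_small e : 0 < e -> exists n, a n < e.
  move=> e0; apply: contrapT => /forallNP ae; apply: infinite_nat.
  have <- : a @^-1` (T `&` [set t | e <= t]) = setT.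
    by apply/seteqP; split=> // n _; split=> //=; rewrite leNgt; apply/negP/ae.
  apply: finite_preimage; last exact: Tfin.
  move=> i j _ _ ij; apply/eqP; rewrite eqn_leq.
  by have [hij hji] := (adec j i, adec i j); rewrite -hij -hji ij lexx.
exists a; split=> //.
- apply/cvgrPdist_lt => e /a_small[N aN]; exists N => // n /= Nn.
  rewrite sub0r normrN gtr0_norm //; apply: le_lt_trans aN.
  by rewrite adec.
- apply/seteqP; split=> [t Tt|t [->//|[n _ <-]//]].
  have := Tpos _ Tt; rewrite /= le_eqVlt => /orP[/eqP<-|t0]; [by left|right].
  have [n an] := a_small _ t0.
  apply: contrapT => tNa; suff : t < a n by rewrite ltNge ltW.
  elim: n {an} => [|n tn].
    have : t <= a 0%N; last by rewrite le_eqVlt => /orP[/eqP tE|//]; case: tNa; exists 0%N.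
    have [_ _ _] := nP _ (ltr_wpDl M0 ltr01); apply => //.
    have [t1|t1] := ltP t 1; first by rewrite ltr_wpDl.
    by rewrite ltr_pwDr //; apply: MP; right.
  have : t <= a n.+1; last by rewrite le_eqVlt => /orP[/eqP tE|//]; case: tNa; exists n.+1.
  by have [_ _ _] := nP _ (a_gt0 n); apply.
Qed.

End real_sets.

(** * Coordinate systems and the extension of isometries *)

Section coordinates.
Context {K : realType}.

(** X looks like a space of functions from the positive reals to nat with
    d(f, g) the largest t where f(t) and g(t) differ. The last clause lets one
    concatenate points: x above r, any value n at r, y below r. *)
Definition coordinate_system (R : set K) (X : metricType K)
    (c : X -> K -> nat) : Prop :=
  [/\ forall x y t, mdist x y < t -> c x t = c y t,
      forall x y, x <> y -> c x (mdist x y) <> c y (mdist x y)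
    & forall x y r n, R r -> 0 < r -> exists z,
        [/\ forall t, r < t -> c z t = c x t, c z r = n
          & forall t, 0 < t -> t < r -> c z t = c y t]].

Context {R : set K} {X : metricType K} (c : X -> K -> nat).
Hypothesis cP : coordinate_system R c.

Let c_agree (x y : X) t : mdist x y < t -> c x t = c y t.
Proof. by case: cP => + _ _; apply. Qed.

Lemma coord_differ (x y : X) : 0 < mdist x y -> c x (mdist x y) <> c y (mdist x y).
Proof. by case: cP => _ + _; rewrite mdist_gt0 => h /eqP; exact: h. Qed.

Lemma coord_mdist_le (x y : X) s : 0 <= s ->
  (forall t, s < t -> c x t = c y t) -> mdist x y <= s.
Proof.
move=> s0 h; rewrite leNgt; apply/negP => sd.
by apply: (@coord_differ x y); [exact: le_lt_trans sd|exact: h].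
Qed.

Lemma coord_ultrametric : ultrametric X.
Proof.
move=> x y z; apply: coord_mdist_le => [|t].
  by rewrite le_max mdist_ge0.
by rewrite gt_max => /andP[xz zy]; rewrite (c_agree xz) (c_agree zy).
Qed.

Lemma ultra_le (x y z : X) t : mdist x z <= t -> mdist z y <= t -> mdist x y <= t.
Proof.
by move=> xz zy; apply: le_trans (coord_ultrametric x y z) _; rewrite ge_max xz.
Qed.

(** The relation between x and its image y under an extension of p i |-> q i.
    Every scale t at which x is within t of some p i lies in the part of the
    tree of balls spanned by p, where coordinates are transported by the
    permutations beta; below the distance from x to p they are left alone.
    Since the distance to p is not mentioned explicitly, matched pairs are
    compared one scale at a time. *)
Definition matched I (p : I -> X) (beta : I -> K -> nat -> nat) (x y : X) :=
  forall t, 0 < t ->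
    (forall i, mdist x (p i) <= t -> c y t = beta i t (c x t)) /\
    ((forall i, t < mdist x (p i)) -> c y t = c x t).

Section matched.
Context {I : Type} (p q : I -> X) (beta : I -> K -> nat -> nat).
Hypothesis pq : forall i j, mdist (q i) (q j) = mdist (p i) (p j).
Hypothesis beta_inj : forall i t, injective (beta i t).
Hypothesis betaE : forall i t, 0 < t -> beta i t (c (p i) t) = c (q i) t.
Hypothesis beta_ball :
  forall i j t, mdist (p i) (p j) <= t -> beta i t = beta j t.

(** At every scale t at least d(x, x'), the points x and x' see the same p i
    within distance t, so they undergo the same injection of coordinates. *)
Lemma matched_isometric x y x' y' :
  matched p beta x y -> matched p beta x' y' -> mdist y y' = mdist x x'.
Proof.
move=> xy x'y'.
have key t : 0 < t -> mdist x x' <= t -> c y t = c y' t <-> c x t = c x' t.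
  move=> t0 xx'; have [[yi yN] [y'i y'N]] := (xy _ t0, x'y' _ t0).
  have [[i xi]|nx] := pselect (exists i, mdist x (p i) <= t).
    have x'i : mdist x' (p i) <= t by apply: ultra_le xi; rewrite metric_sym.
    by rewrite (yi _ xi) (y'i _ x'i); split=> [/beta_inj//|->].
  rewrite yN ?y'N // => i; rewrite ltNge; apply/negP => xi; apply: nx; exists i => //.
  exact: ultra_le xi.
apply/eqP; rewrite eq_le; apply/andP; split.
  apply: coord_mdist_le (mdist_ge0 _ _) _ => t xt.
  by apply/(key t (le_lt_trans (mdist_ge0 _ _) xt) (ltW xt)); apply: c_agree.
rewrite leNgt; apply/negP => yx.
have x0 : 0 < mdist x x' by exact: le_lt_trans (mdist_ge0 _ _) yx.
by apply: (coord_differ x0); apply/(key _ x0 (lexx _)); exact: c_agree.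
Qed.

Lemma matched_points i : matched p beta (p i) (q i).
Proof.
move=> t t0; split=> [j ij|/(_ i)]; first by rewrite -(betaE i t0) (beta_ball ij).
by rewrite mdistxx ltNge ltW.
Qed.

Hypothesis Rval : valued R X.
Hypothesis nearest : forall (x : X) (i0 : I),
  exists i, forall j, mdist x (p i) <= mdist x (p j).

(** Concatenate the image of a nearest point p i above r = d(x, p i), the
    permuted coordinate at r, and x itself below r. *)
Lemma matched_total x : exists y, matched p beta x y.
Proof.
have [[i0 _]|I0] := pselect (exists i : I, True); last first.
  by exists x => t _; split=> // i; case: I0; exists i.
have [i xi] := nearest x i0.
have := mdist_ge0 x (p i); rewrite le_eqVlt => /orP[/eqP/esym/mdist_positivity->|r0].
  by exists (q i); exact: matched_points.
have [_ _ glue] := cP; pose r := mdist x (p i).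
have [y [ygt yr ylt]] := glue (q i) x r (beta i r (c x r)) (Rval _ _) r0.
exists y => t t0; split=> [j xj|xN].
  have rt : r <= t by apply: le_trans (xi j) xj.
  have <- : beta i t = beta j t.
    by apply: beta_ball; apply: ultra_le xj; rewrite metric_sym.
  move: rt; rewrite le_eqVlt => /orP[/eqP<-//|rt].
  by rewrite ygt // -(betaE i t0) (c_agree rt).
by rewrite ylt //; exact: xN.
Qed.

End matched.

(** Thus the relation built from the inverse data yields surjectivity. The point
    is that d(x, p i) = d(y, q i), because the pairs (q i, p i) are
    themselves matched and matching preserves distances. *)
Lemma matched_inverse I (p q : I -> X) (beta gamma : I -> K -> nat -> nat) x y :
    (forall i j, mdist (q i) (q j) = mdist (p i) (p j)) ->
    (forall i t, cancel (gamma i t) (beta i t)) ->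
    (forall i t, 0 < t -> gamma i t (c (q i) t) = c (p i) t) ->
    (forall i j t, mdist (q i) (q j) <= t -> gamma i t = gamma j t) ->
  matched q gamma y x -> matched p beta x y.
Proof.
move=> pq gammaK gammaE gamma_ball yx.
have xy i : mdist x (p i) = mdist y (q i).
  apply: (@matched_isometric _ q gamma); first by move=> ? ?; exact: can_inj.
    exact: yx.
  by apply: matched_points.
move=> t t0; have [xi xN] := yx t t0; split=> [i|tx].
  by rewrite xy => /xi->; rewrite gammaK.
by rewrite xN // => i; rewrite -xy.
Qed.

End coordinates.


Section compact_extension.
Context {K : realType} {R : set K} {X : metricType K} (c : X -> K -> nat).
Hypothesis cP : coordinate_system R c.
Hypothesis Rval : valued R X.

(** Compactness in the form used below: a covering by balls of variable
    radius. It is invariant under isometric change of p, so that it serves for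
    the domain of a partial isometry and for its image alike. *)
Definition gauge_compact (I : eqType) (p : I -> X) :=
  forall eps : I -> K, (forall i, 0 < eps i) ->
    exists s : seq I, forall j, exists2 i, i \in s & mdist (p i) (p j) < eps i.

Lemma compact_gauge (A : set X) : compact A -> gauge_compact (\val : A -> X).
Proof.
move=> cA eps eps0.
(* the covering form of compactness is used in a pointed space, with a point
   of A as base point *)
have [[a0 _]|A0] := pselect (exists a : A, True); last first.
  by exists [::] => a; case: A0; exists a.
pose T : ptopologicalType := HB.pack X (isPointed.Build X (\val a0)).
have {}cA : cover_compact (A : set T) by rewrite -(@compact_cover T).
have [|a Aa|D _ DA] := cA A setT (fun i : A => (ball (\val i) (eps i))^°).
- by move=> i _; exact: open_interior.
- have [i <-] : exists i : A, \val i = a by exists (exist _ a (mem_set Aa)).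
  by exists i => //; exact: nbhsx_ballx.
- exists (finmap.enum_fset D) => j.
  have [i iD /interior_subset] := DA _ (set_valP j).
  by rewrite ballEmdist => ij; exists i.
Qed.

(** When x is at positive distance from every q i, the distance to x is
    constant on the ball about q i of radius d(x, q i), so finitely many of
    these balls already exhibit every distance. *)
Lemma gauge_compact_nearest (I : eqType) (p q : I -> X) x :
    (forall i j, mdist (q i) (q j) = mdist (p i) (p j)) ->
    gauge_compact p -> forall i0 : I,
  exists i, forall j, mdist x (q i) <= mdist x (q j).
Proof.
move=> pq netp i0.
have [[i xi]|x0] := pselect (exists i, mdist x (q i) = 0).
  by exists i => j; rewrite xi mdist_ge0.
have [|s sP] := netp (fun i => mdist x (q i)).
  move=> i; rewrite lt_neqAle mdist_ge0 andbT eq_sym.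
  by apply/eqP => xi; apply: x0; exists i.
have [||m [i is_ <-] mP] := @finite_set_min _ ((fun i => mdist x (q i)) @` [set` s]).
- exact/finite_image/finite_seq.
- by have [i is_ _] := sP i0; exists (mdist x (q i)), i.
exists i => j; have [k ks kj] := sP j.
apply: le_trans (mP _ _) _; first by exists k.
rewrite leNgt; apply/negP => jk.
have := coord_ultrametric cP x (q k) (q j).
by rewrite leNgt gt_max jk (metric_sym (q j)) pq kj.
Qed.

(** In a ball of radius t, the coordinates at t of the points p j take finitely
    many values by compactness, and those of p j and p k agree exactly when
    those of q j and q k do. This gives a finite partial injection to be
    extended to a permutation of nat. *)
Lemma ball_bijections (I : eqType) (p q : I -> X) :
    (forall i j, mdist (q i) (q j) = mdist (p i) (p j)) ->
    gauge_compact p ->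
  exists beta : I -> K -> nat -> nat,
    [/\ forall i t, bijective (beta i t),
        forall i t, 0 < t -> beta i t (c (p i) t) = c (q i) t
      & forall i j t, mdist (p i) (p j) <= t -> beta i t = beta j t].
Proof.
move=> pq netp; have [c_agree _ _] := cP.
have f_ex (P : set (nat * nat)) : exists g : nat -> nat,
    bijective g /\ (finite_set P ->
      (forall u v, P u -> P v -> u.1 = v.1 <-> u.2 = v.2) ->
      forall u, P u -> g u.1 = u.2).
  have [[s PE]|Pinf] := pselect (exists s : seq (nat * nat), P = [set` s]); last first.
    by exists id; split=> [|/finite_seqP//]; exists id.
  have [Pinj|nPinj] := pselect {in s &, forall u v, u.1 = v.1 <-> u.2 = v.2}.
    have [g [bg gE]] := permutation_extending Pinj; exists g; split=> // _ _ u.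
    by rewrite PE; exact: gE.
  exists id; split; first by exists id.
  by rewrite PE => _ h; case: nPinj => u v us vs; exact: h.
have {f_ex}[f fP] := choice f_ex.
(* f is a function of the graph alone, hence balls with the same points get the
   same permutation *)
pose P i t := [set (c (p j) t, c (q j) t) | j in [set j | mdist (p i) (p j) <= t]].
have Pball i j t : mdist (p i) (p j) <= t -> P i t = P j t.
  move=> ij; rewrite /P; congr (_ @` _); apply/seteqP; split=> k /= kt.
    by apply: (ultra_le cP _ kt); rewrite metric_sym.
  exact: (ultra_le cP ij kt).
have Pinj i t : 0 < t -> forall u v, P i t u -> P i t v -> u.1 = v.1 <-> u.2 = v.2.
  move=> t0 _ _ [j ij <-] [k ik <-] /=.
  have : mdist (p j) (p k) <= t by apply: (ultra_le cP _ ik); rewrite metric_sym.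
  rewrite le_eqVlt => /orP[/eqP jkt|jkt]; last first.
    by rewrite (c_agree _ _ _ jkt) (c_agree (q j) (q k)) ?pq.
  have pjk := @coord_differ _ _ _ _ cP (p j) (p k).
  have qjk := @coord_differ _ _ _ _ cP (q j) (q k).
  by rewrite pq jkt in qjk; rewrite jkt in pjk; split=> [/pjk|/qjk]; case.
have Pfin i t : 0 < t -> finite_set (P i t).
  move=> t0; have [//|s sP] := netp (fun=> t).
  apply: (@sub_finite_set _ _ ((fun j => (c (p j) t, c (q j) t)) @` [set` s])).
    move=> _ [j /= ij <-]; have [k ks kj] := sP j; exists k => //.
    by rewrite (c_agree _ _ _ kj) (c_agree (q k) (q j)) ?pq.
  exact/finite_image/finite_seq.
exists (fun i t => f (P i t)); split=> [i t|i t t0|i j t ij].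
- by case: (fP (P i t)).
- have [_ /(_ (Pfin i t t0) (Pinj i t t0) (c (p i) t, c (q i) t))] := fP (P i t).
  by apply; exists i; rewrite //= mdistxx ltW.
- by rewrite (Pball i j).
Qed.

Lemma compact_extension (A : set X) : compact A -> extends_isometries A.
Proof.
move=> /compact_gauge netA phi phi_isom.
have pq (a b : A) : mdist (phi a) (phi b) = mdist (\val a) (\val b) by exact: phi_isom.
have [beta [beta_bij betaE beta_ball]] := ball_bijections pq netA.
have inv_ex (at_ : A * K) : exists g : nat -> nat,
    cancel (beta at_.1 at_.2) g /\ cancel g (beta at_.1 at_.2).
  by have [g betaK gK] := beta_bij at_.1 at_.2; exists g.
have [inv invP] := choice inv_ex; pose gamma a t := inv (a, t).
have gammaP a t : cancel (beta a t) (gamma a t) /\ cancel (gamma a t) (beta a t).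
  exact: (invP (a, t)).
have gammaE a t : 0 < t -> gamma a t (c (phi a) t) = c (\val a) t.
  by move=> t0; rewrite -betaE // (gammaP a t).1.
have gamma_ball a b t : mdist (phi a) (phi b) <= t -> gamma a t = gamma b t.
  rewrite pq => /beta_ball ab; apply/funext => n.
  by rewrite -{1}[n](gammaP b t).2 -ab (gammaP a t).1.
have nearA x a := gauge_compact_nearest x (fun _ _ => erefl) netA a.
have nearB x a := gauge_compact_nearest x pq netA a.
have [F FP] := choice (matched_total cP betaE beta_ball Rval nearA).
have [G GP] := choice (matched_total cP gammaE gamma_ball Rval nearB).
have beta_inj a t := bij_inj (beta_bij a t).
have FG x y : matched c (\val : A -> X) beta x y -> F x = y.
  by move=> xy; apply: mdist_positivity; rewrite (matched_isometric cP beta_inj (FP x) xy) mdistxx.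
exists F; split; last by move=> a; apply: FG; exact: matched_points.
have Fisom x y : mdist (F x) (F y) = mdist x y by exact: (matched_isometric cP beta_inj).
split=> //; exists G => [x|y]; last first.
  by apply: FG; apply: (matched_inverse cP pq _ _ _ (GP y)) => // a t; exact: (gammaP a t).2.
apply: mdist_positivity; rewrite -Fisom.
suff -> : F (G (F x)) = F x by rewrite mdistxx.
by apply: FG; apply: (matched_inverse cP pq _ _ _ (GP _)) => // a t; exact: (gammaP a t).2.
Qed.

End compact_extension.

(** * Consequences of the Urysohn property for a subspace *)

Section equilateral.
Context {K : realType}.

(** A separate type, since the ordinals may carry another metric; r is a
    parameter of the type on which the instances below depend. *)
Definition equilateral (r : {posnum K}) (n : nat) : Type := 'I_n.

Context (r : {posnum K}) (n : nat).
HB.instance Definition _ := Choice.on (equilateral r n).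

Let dist (i j : equilateral r n) : K := if i == j then 0 else r%:num.

Let distxx i : dist i i = 0. Proof. by rewrite /dist eqxx. Qed.

Let dist_eq0 i j : dist i j = 0 -> i = j.
Proof. by rewrite /dist; case: eqP => // _ /eqP; rewrite gt_eqF. Qed.

Let dist_sym i j : dist i j = dist j i.
Proof. by rewrite /dist eq_sym. Qed.

Let dist_ultra i j k : dist i j <= Num.max (dist i k) (dist k j).
Proof.
rewrite le_max /dist; case: (i =P j) => [_|ij]; first by case: ifP; rewrite ?lexx //= ltW.
by case: (i =P k) => [<-|_]; rewrite ?lexx //; move/eqP/negPf: ij => ->; rewrite lexx orbT.
Qed.

Let dist_triangle j i k : dist i k <= dist i j + dist j k.
Proof.
apply: le_trans (dist_ultra i k j) _.
have dist_ge0 a b : 0 <= dist a b by rewrite /dist; case: ifP.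
by rewrite ge_max lerDl lerDr !dist_ge0.
Qed.

HB.instance Definition _ := isMetric.Build K (equilateral r n)
  distxx dist_eq0 dist_sym dist_triangle.

Lemma equilateral_dist (i j : equilateral r n) :
  mdist i j = if i == j then 0 else r%:num.
Proof. by []. Qed.

Lemma equilateral_finite (S : set K) : S 0 -> S r%:num ->
  finite_valued_ultrametric S (equilateral r n : metricType K).
Proof.
move=> S0 Sr; split; first exact: (@finite_finset 'I_n).
split; first by move=> i j k; exact: dist_ultra.
by move=> i j; rewrite equilateral_dist; case: ifP.
Qed.

End equilateral.

Lemma natSinv_lt (K : realType) (e : K) : 0 < e -> exists n, n.+1%:R^-1 < e.
Proof.
move=> e0; have [N _ NP] := near_infty_natSinv_lt (PosNum e0).
by exists N; exact: (NP N (leqnn _)).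
Qed.

Section urysohn_subspace.
Context {K : realType} {X : metricType K} (S : set K) (A : set X).
Context (U : metricType K) (SU : urysohn S U) (AU : isometric A U).

(** The isometry of A with U as maps between X and U, so that the facts below
    speak of points of X instead of a subtype. *)
Lemma urysohn_chart : exists (f : X -> U) (g : U -> X),
  [/\ forall x y, A x -> A y -> mdist (f x) (f y) = mdist x y,
      forall u v, mdist (g u) (g v) = mdist u v,
      forall u, A (g u),
      forall x, A x -> g (f x) = x & cancel g f].
Proof.
have [h [hisom [k hk kh]]] := AU; have [[u0 _] _ _ _ _] := SU.
pose f x := if pselect (A x) is left Ax then h (exist _ x (mem_set Ax)) else u0.
have fE (a : A) : f (\val a) = h a.
  rewrite /f; case: pselect => [Aa|]; last by case; exact: set_valP.
  by congr h; exact: val_inj.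
have valE x : A x -> exists a : A, x = \val a.
  by move=> Ax; exists (exist _ x (mem_set Ax)).
exists f, (fun u => \val (k u)); split=> [x y /valE[a ->] /valE[b ->]|u v|u|x /valE[a ->]|u].
- by rewrite !fE hisom.
- by rewrite -[u in RHS]kh -[v in RHS]kh hisom.
- exact: set_valP.
- by rewrite fE hk.
- by rewrite fE kh.
Qed.

Lemma urysohn_nonempty : A !=set0.
Proof.
have [f [g [_ _ Ag _ _]]] := urysohn_chart.
by have [[u _] _ _ _ _] := SU; exists (g u).
Qed.

Lemma urysohn_valued x y : A x -> A y -> S (mdist x y).
Proof.
have [f [g [fi _ _ _ _]]] := urysohn_chart; move=> Ax Ay.
by have [_ _ _ _ [_ SUv]] := SU; rewrite -fi.
Qed.

(** Injectivity applied to the inclusion of one point into an equilateral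
    space. *)
Lemma urysohn_equilateral (r : K) n p : S 0 -> S r -> 0 < r -> A p ->
  exists theta : 'I_n.+1 -> X, [/\ theta ord0 = p, forall i, A (theta i)
    & forall i j, i != j -> mdist (theta i) (theta j) = r].
Proof.
move=> S0 Sr r0 Ap; have [f [g [_ gi Ag gf _]]] := urysohn_chart.
have [_ _ _ Uinj _] := SU; pose r' := PosNum r0.
have [||theta [thi th0]] := @Uinj (equilateral r' 1) (equilateral r' n.+1)
  (equilateral_finite 1 S0 Sr) (equilateral_finite n.+1 S0 Sr)
  (fun=> ord0) (fun=> f p).
- by move=> i j; rewrite !equilateral_dist eqxx (ord1 i) (ord1 j) eqxx.
- by move=> i j; rewrite !equilateral_dist mdistxx (ord1 i) (ord1 j) eqxx.
exists (fun i => g (theta i)); split=> [|i|i j ij]; last 2 first.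
- exact: Ag.
- by rewrite gi thi equilateral_dist (negPf ij).
- by have /(congr1 (fun h => h ord0)) /= -> := th0; exact: gf.
Qed.

Lemma urysohn_countable_dense : exists2 D : set X, countable D
  & forall x e, A x -> 0 < e -> exists2 y, D y & mdist x y < e.
Proof.
have [f [g [_ gi Ag gf fg]]] := urysohn_chart.
have [_ [D [cD dD]] _ _ _] := SU.
exists (g @` D); first exact: card_le_trans (card_image_le _ _) cD.
move=> x e Ax e0; have [||u [/interior_subset xu Du]] := dD (ball (f x) e)^°.
- by exists (f x); exact: nbhsx_ballx.
- exact: open_interior.
exists (g u); first by exists u.
by move: xu; rewrite ballEmdist /= -{2}(gf _ Ax) gi.
Qed.

Lemma urysohn_limit (u : nat -> X) : (forall n, A (u n)) ->
    (forall n m, (n <= m)%N -> mdist (u n) (u m) <= n.+1%:R^-1) ->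
  exists2 x, A x & forall n, mdist x (u n) <= n.+1%:R^-1.
Proof.
move=> Au ucauchy; have [f [g [fi gi Ag gf fg]]] := urysohn_chart.
have [_ _ Ucomp _ [Uultra _]] := SU.
have [|x xu] := Ucomp ((f \o u) @ \oo).
  apply: cauchy_exP => e e0.
  have [N Ne] := natSinv_lt e0.
  exists (f (u N)); exists N => // n Nn; rewrite /= ballEmdist /= fi //.
  exact: le_lt_trans (ucauchy _ _ Nn) Ne.
exists (g x) => // n.
have n0 : 0 < n.+1%:R^-1 :> K by [].
have /metricType_numDomainType.cvgrPdist_lt/(_ _ n0)[N _ xN] := xu.
have := xN (maxn N n) (leq_maxl _ _); rewrite /= => /ltW xm.
rewrite -[u n](gf _ (Au n)) gi; apply: le_trans (Uultra _ _ (f (u (maxn N n)))) _.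
by rewrite ge_max xm metric_sym fi // ucauchy // leq_maxr.
Qed.

End urysohn_subspace.

(** * Coordinates from a petal *)

Section petal_coordinates.
Context {K : realType} {R : set K} {X : metricType K} (Pi : set K -> set X).
Hypotheses (R_range : range_set R) (X_ultra : ultrametric X) (X_valued : valued R X).
Hypothesis (X_petal : petal R Pi).

Let ultra_le (x y z : X) t : mdist x z <= t -> mdist z y <= t -> mdist x y <= t.
Proof.
by move=> xz zy; apply: le_trans (X_ultra x y z) _; rewrite ge_max xz.
Qed.

Let TEN_intro S : S `<=` R -> S 0 -> locally_finite_pos S -> TEN R S.
Proof.
move=> SR S0 Sfin; split=> //; apply: locally_finite_tenuous => //.
by move=> s /SR; case: R_range => + _; apply.
Qed.

Let finite_TEN S : S `<=` R -> S 0 -> finite_set S -> TEN R S.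
Proof.
by move=> SR S0 fS; apply: TEN_intro => // e _; apply: sub_finite_set fS => ? [].
Qed.

Let TEN_locally_finite S : TEN R S -> locally_finite_pos S.
Proof. by case=> _ /tenuous_locally_finite. Qed.

Lemma petal_mono S T : TEN R S -> TEN R T -> S `<=` T -> Pi S `<=` Pi T.
Proof.
move=> tS tT ST x; have [_ _ PI _] := X_petal.
by rewrite -{1}(setIidl ST) -PI // => -[].
Qed.

Lemma petal_valued S x y : TEN R S -> Pi S x -> Pi S y -> S (mdist x y).
Proof.
case: X_petal => PU _ _ _ tS; have [U SU AU] := PU _ tS; exact: urysohn_valued SU AU _ _.
Qed.

(** If no point of Pi S were nearest to x, every distance from x to Pi S would
    also be a distance between two points of Pi S, hence lie in the finite set
    S, and a least one would exist after all. The infimum being attained, the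
    petal axiom on distances applies to d(x, w). *)
Lemma petal_nearest S T x : TEN R S -> finite_set S -> TEN R T -> Pi T x ->
  exists2 w, Pi S w & (forall v, Pi S v -> mdist x w <= mdist x v) /\
                      ((T `\` S) `|` [set 0]) (mdist x w).
Proof.
move=> tS fS tT xT; have [PU _ _ PD] := X_petal.
have [w0 Sw0] : Pi S !=set0.
  by have [U SU AU] := PU _ tS; exact: urysohn_nonempty SU AU.
have [w Sw wP] : exists2 w, Pi S w & forall v, Pi S v -> mdist x w <= mdist x v.
  apply: contrapT => nw.
  have closer w : Pi S w -> exists2 v, Pi S v & mdist x v < mdist x w.
    move=> Sw; apply: contrapT => nv; apply: nw; exists w => // v Sv.
    by rewrite leNgt; apply/negP => vw; apply: nv; exists v.
  have [||_ [w Sw <-] wP] := @finite_set_min _ ((fun w => mdist x w) @` Pi S).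
  - apply: sub_finite_set fS => _ [w Sw <-]; have [v Sv vw] := closer _ Sw.
    have -> : mdist x w = mdist w v; last exact: petal_valued.
    have := X_ultra x w v; rewrite le_max (metric_sym v) [_ <= mdist x v]leNgt vw /= => h.
    apply/eqP; rewrite eq_le h /=; apply: ultra_le (ltW vw).
    by rewrite metric_sym.
  - by exists (mdist x w0), w0.
  by have [v Sv] := closer _ Sw; rewrite ltNge wP //; exists v.
exists w => //; split=> //; have := PD S T x tS tT xT.
suff -> : dist_to_set x (Pi S) = mdist x w by [].
apply/eqP; rewrite eq_le; apply/andP; split.
  by apply: ge_inf; [exists 0 => _ [v _ <-]; exact: mdist_ge0|exists w].
by apply: lb_le_inf; [exists (mdist x w), w|move=> _ [v Sv <-]; exact: wP].
Qed.

(** Centers single out one point of each closed ball of radius r, playing the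
    role of the point whose coordinates at scales at most r all vanish. *)
Definition center (r : K) (p : X) := exists S,
  [/\ TEN R S, finite_set S, forall s, S s -> 0 < s -> r < s & Pi S p].

(** Both points lie in the piece of a union whose positive elements all exceed
    r, so their distance cannot be positive and at most r. *)
Lemma center_unique r p q : center r p -> center r q -> mdist p q <= r -> p = q.
Proof.
move=> [S [tS fS rS Sp]] [T [tT fT rT Tq]] pq.
have tST : TEN R (S `|` T).
  apply: finite_TEN; [|by left; case: tS|by rewrite finite_setU].
  by move=> s [Ss|Ts]; [case: tS => /(_ _ Ss)|case: tT => /(_ _ Ts)].
have Pp : Pi (S `|` T) p by apply: petal_mono Sp => // s; left.
have Pq : Pi (S `|` T) q by apply: petal_mono Tq => // s; right.
have := petal_valued tST Pp Pq => STpq.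
apply: mdist_positivity; apply: contrapT => /eqP pq0.
have {}pq0 : 0 < mdist p q by rewrite lt_neqAle eq_sym pq0 mdist_ge0.
have : r < mdist p q by case: STpq => ?; [exact: rS|exact: rT].
by rewrite ltNge pq.
Qed.

(** The center is the point nearest to x in the piece of the part of T above r.
    Keeping it in Pi T is what later confines the support of the coordinates of
    x to T. *)
Lemma petal_center T x r : TEN R T -> Pi T x -> 0 < r ->
  exists p, [/\ center r p, Pi T p & mdist x p <= r].
Proof.
move=> tT Tx r0; pose S := (T `&` [set t | r < t]) `|` [set 0].
have ST : S `<=` T by move=> s [[]//|->]; case: tT.
have fS : finite_set S.
  rewrite finite_setU; split; last exact: finite_set1.
  by apply: sub_finite_set (TEN_locally_finite tT r0) => t [Tt /ltW].
have tS : TEN R S.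
  apply: finite_TEN => //; last by right.
  by move=> s /ST; case: tT => + _ _; apply.
have [p Sp [_ xp]] := petal_nearest tS fS tT Tx.
exists p; split; last 2 first.
- exact: petal_mono Sp.
- case: xp => [[Td nSd]|->]; last exact: ltW.
  by rewrite leNgt; apply/negP => rd; apply: nSd; left.
by exists S; split=> // s [[_ //]|->]; rewrite ltxx.
Qed.

Lemma petal_of_point x : exists2 T, TEN R T & Pi T x.
Proof.
have [_ PX _ _] := X_petal.
by have : [set: X] x by []; rewrite -PX => -[T tT Tx]; exists T.
Qed.

(** Every open r-ball inside the closed r-ball about p meets Pi (S U {r}).
    Truncating a piece through y at r moves y by less than r, to some z; the
    distance from z to Pi (S U {r}) is at most r, yet if nonzero it would be
    an element of the truncation other than r, hence exceed r. *)
Lemma child_representative S p r y : TEN R S -> finite_set S ->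
    (forall s, S s -> 0 < s -> r < s) -> Pi S p -> R r -> 0 < r ->
    mdist p y <= r ->
  exists2 z, Pi (S `|` [set r]) z & mdist y z < r.
Proof.
move=> tS fS rS Sp Rr r0 py; have [T tT Ty] := petal_of_point y.
pose U := (T `&` [set t | r <= t]) `|` [set 0].
have UT : U `<=` T by move=> s [[]//|->]; case: tT.
have fU : finite_set U.
  rewrite finite_setU; split; last exact: finite_set1.
  exact: (TEN_locally_finite tT r0).
have tU : TEN R U.
  apply: finite_TEN => //; last by right.
  by move=> s /UT; case: tT => + _ _; apply.
have [z Uz [_ yz]] := petal_nearest tU fU tT Ty.
have {}yz : mdist y z < r.
  case: yz => [[Td nUd]|->//].
  by rewrite ltNge; apply/negP => rd; apply: nUd; left.
have fS' : finite_set (S `|` [set r]).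
  by rewrite finite_setU; split=> //; exact: finite_set1.
have tS' : TEN R (S `|` [set r]).
  apply: finite_TEN => //; last by left; case: tS.
  by move=> s [|->//]; case: tS => + _ _; apply.
have [w S'w [wP zw]] := petal_nearest tS' fS' tU Uz.
have S'p : Pi (S `|` [set r]) p by apply: petal_mono Sp => // s; left.
have zwr : mdist z w <= r.
  apply: le_trans (wP _ S'p) _; apply: (@ultra_le _ _ y).
    by rewrite metric_sym ltW.
  by rewrite metric_sym.
exists w => //; suff -> : w = z by [].
apply/esym/mdist_positivity.
case: zw => [[Ud nS'd]|//]; case: Ud => [[_ /= rd]|//].
by case: nS'd; right; apply/eqP; rewrite eq_le zwr.
Qed.

(** There are countably many open r-balls in the closed r-ball about p, by
    separability of Pi (S U {r}), and infinitely many because that piece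
    contains arbitrarily large equilateral sets of side r through p. A numbering
    g of them can be chosen to give the number 0 to the ball of p. *)
Lemma child_numbering r p : R r -> 0 < r -> center r p ->
  exists g : X -> nat,
    [/\ g p = 0%N,
        forall x y, mdist p x <= r -> mdist p y <= r ->
          g x = g y <-> mdist x y < r
      & forall n, exists2 x, mdist p x <= r & g x = n].
Proof.
move=> Rr r0 [S [tS fS rS Sp]].
pose child (y : X) : set X := [set z | mdist y z < r].
have childE y z : child y = child z <-> mdist y z < r.
  split=> yz.
    suff : child y z by []; rewrite yz; by rewrite /child /= mdistxx.
  apply/seteqP; split=> x; rewrite /child /= => h.
    by apply: le_lt_trans (X_ultra _ _ y) _; rewrite gt_max h metric_sym yz.
  by apply: le_lt_trans (X_ultra _ _ z) _; rewrite gt_max h yz.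
pose E := child @` [set y | mdist p y <= r].
have fS' : finite_set (S `|` [set r]).
  by rewrite finite_setU; split=> //; exact: finite_set1.
have tS' : TEN R (S `|` [set r]).
  apply: finite_TEN => //; last by left; case: tS.
  by move=> s [|->//]; case: tS => + _ _; apply.
have S'p : Pi (S `|` [set r]) p by apply: petal_mono Sp => // s; left.
have [PU _ _ _] := X_petal; have [U SU AU] := PU _ tS'.
have cE : countable E.
  have [D cD DP] := urysohn_countable_dense SU AU.
  apply: sub_countable cD; apply: (card_le_trans _ (card_image_le child D)).
  apply: subset_card_le => _ [y py <-].
  have [z S'z yz] := child_representative tS fS rS Sp Rr r0 py.
  have [d Dd zd] := DP _ _ S'z r0; exists d => //.
  by apply/esym/childE; apply: le_lt_trans (X_ultra _ _ z) _; rewrite gt_max yz zd.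
have iE : ~ finite_set E.
  move=> /finite_seqP[s Es].
  have S'0 : (S `|` [set r]) 0 by left; case: tS.
  have [theta [th0 _ thr]] :=
    urysohn_equilateral SU AU (size s) S'0 (or_intror erefl) r0 S'p.
  pose t := [seq child (theta i) | i <- enum 'I_(size s).+1].
  have : (size t <= size s)%N.
    apply: uniq_leq_size.
      rewrite map_inj_uniq ?enum_uniq // => i j /childE.
      by apply: contraPP => /eqP ij; rewrite thr // ltxx.
    move=> _ /mapP[i _ ->]; have : E (child (theta i)).
      exists (theta i) => //=; rewrite -th0.
      by have [->|/thr->//] := eqVneq ord0 i; rewrite mdistxx ltW.
    by rewrite Es.
  by rewrite size_map size_enum_ord ltnn.
have /card_set_bijP[h [_ hinj hsurj]] := eq_card_nat cE iE.
have [f [bf fE]] : exists f : nat -> nat, bijective f /\ {in [:: (h (child p), 0%N)], forall u, f u.1 = u.2}.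
  by apply: permutation_extending => u v; rewrite !inE => /eqP-> /eqP->.
exists (fun x => f (h (child x))); split=> [|x y px py|n].
- by have := fE (h (child p), 0%N); apply; rewrite inE.
- split=> [/(bij_inj bf)/hinj|/childE->//].
  by rewrite !inE => xy; apply/childE/xy; [exists x|exists y].
- have [k _ kf] := bf; have [_ [x px <-] hx] := hsurj (k n) I.
  by exists x => //; rewrite hx kf.
Qed.

Definition petal_coordinates (ctr : K -> X -> X) (num : K -> X -> X -> nat)
    (x : X) (t : K) : nat :=
  if `[< R t /\ 0 < t >] then num t (ctr t x) x else 0%N.

Section coordinates_of_centers.
Context (ctr : K -> X -> X) (num : K -> X -> X -> nat).
Hypothesis ctrP : forall r x, 0 < r -> center r (ctr r x) /\ mdist x (ctr r x) <= r.
Hypothesis numP : forall r p, R r -> 0 < r -> center r p ->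
  [/\ num r p p = 0%N,
      forall x y, mdist p x <= r -> mdist p y <= r ->
        num r p x = num r p y <-> mdist x y < r
    & forall n, exists2 x, mdist p x <= r & num r p x = n].

Local Notation c := (petal_coordinates ctr num).

Let ctr_eq r x p : 0 < r -> center r p -> mdist x p <= r -> ctr r x = p.
Proof.
move=> r0 rp xp; have [rc xc] := ctrP x r0; apply: center_unique rc rp _.
by apply: ultra_le xp; rewrite metric_sym.
Qed.

Let ctr_ball r x y : 0 < r -> mdist x y <= r -> ctr r x = ctr r y.
Proof.
move=> r0 xy; have [rc yc] := ctrP y r0; apply: ctr_eq => //.
exact: ultra_le xy yc.
Qed.

Let cE x t : R t -> 0 < t -> c x t = num t (ctr t x) x.
Proof. by move=> Rt t0; rewrite /petal_coordinates asboolT. Qed.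

Let c0 x t : ~ (R t /\ 0 < t) -> c x t = 0%N.
Proof. by move=> h; rewrite /petal_coordinates asboolF. Qed.

Let c_iff x y t : R t -> 0 < t -> mdist x y <= t -> c x t = c y t <-> mdist x y < t.
Proof.
move=> Rt t0 xy; have [rc yc] := ctrP y t0.
have [_ h _] := numP Rt t0 rc.
rewrite !cE // (ctr_ball t0 xy); apply: h; last by rewrite metric_sym.
by rewrite metric_sym; exact: ultra_le xy yc.
Qed.

Let c_agree x y t : mdist x y < t -> c x t = c y t.
Proof.
move=> xy; have [[Rt t0]|h] := pselect (R t /\ 0 < t); last by rewrite !c0.
by apply/c_iff => //; exact: ltW.
Qed.

Let c_differ x y : x <> y -> c x (mdist x y) <> c y (mdist x y).
Proof.
move=> /eqP; rewrite -mdist_gt0 => xy.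
by move/(c_iff (X_valued x y) xy (lexx _)); rewrite ltxx.
Qed.

(** A nonzero coordinate at t means that x is at distance exactly t from its
    center, and this center belongs to Pi T as well. *)
Lemma petal_support T x t : TEN R T -> Pi T x -> c x t <> 0%N -> T t.
Proof.
move=> tT Tx xt.
have [[Rt t0]|/c0//] := pselect (R t /\ 0 < t).
have [p [rp Tp xp]] := petal_center tT Tx t0.
have [np h _] := numP Rt t0 rp.
move: xp; rewrite le_eqVlt => /orP[/eqP<-|xp]; first exact: petal_valued.
case: xt; rewrite cE // (ctr_eq t0 rp (ltW xp)) -np.
by apply/h; rewrite ?mdistxx ?ltW // metric_sym.
Qed.

(** The scales are treated from the largest down. The point x built for the
    scales above r is its own center at r; move to the open r-ball of number
    f r and choose there a representative in the right piece. *)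
Lemma realise_finite (f : K -> nat) (s : seq K) :
    {in s, forall t, R t /\ 0 < t} -> pairwise (fun u v => v < u) s ->
  exists2 x, Pi ([set` s] `|` [set 0]) x & {in s, forall t, c x t = f t}.
Proof.
have s_TEN (u : seq K) : {in u, forall t, R t /\ 0 < t} ->
    finite_set ([set` u] `|` [set 0]) /\ TEN R ([set` u] `|` [set 0]).
  move=> uR; have fu : finite_set ([set` u] `|` [set 0]).
    by rewrite finite_setU; split; [exact: finite_seq|exact: finite_set1].
  split=> //; apply: finite_TEN => //; last by right.
  by move=> t [/uR[]//|->]; case: R_range.
elim/last_ind: s => [|s r IH] sR.
  have [_ t0] := s_TEN _ sR; have [PU _ _ _] := X_petal.
  by have [U SU AU] := PU _ t0; have [x Ux] := urysohn_nonempty SU AU; exists x.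
rewrite pairwise_rcons => /andP[/allP sr ss].
have [Rr r0] : R r /\ 0 < r by apply: sR; rewrite mem_rcons mem_head.
have s'R : {in s, forall t, R t /\ 0 < t}.
  by move=> t ts; apply: sR; rewrite mem_rcons inE ts orbT.
have [x Sx xf] := IH s'R ss.
have [fS tS] := s_TEN _ s'R; have [fS' tS'] := s_TEN _ sR.
have S'E : ([set` s] `|` [set 0]) `|` [set r] = [set` rcons s r] `|` [set 0].
  apply/seteqP; split=> t /=; rewrite mem_rcons inE.
    by move=> [[->|->]|->]; rewrite ?eqxx ?orbT; [left|right|left].
  by move=> [/orP[/eqP->|->]|->]; [right|left; left|left; right].
have rS t : ([set` s] `|` [set 0]) t -> 0 < t -> r < t.
  by move=> [/sr//|->]; rewrite ltxx.
have rx : center r x by exists ([set` s] `|` [set 0]).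
have [_ _ /(_ (f r))[y xy yf]] := numP Rr r0 rx.
have [z Sz yz] := child_representative tS fS rS Sx Rr r0 xy.
rewrite S'E in Sz; exists z => // t; rewrite mem_rcons inE => /orP[/eqP->|ts].
  rewrite -(c_agree yz) cE // (_ : ctr r y = x) //; apply: ctr_eq => //.
  by rewrite metric_sym.
rewrite -xf //; apply: c_agree; rewrite metric_sym.
apply: le_lt_trans (sr _ ts); exact: ultra_le xy (ltW yz).
Qed.

(** Realise the truncations of f at levels 1/(n+1), all in Pi T; they form a
    Cauchy sequence, and Pi T is complete. *)
Lemma realise (T : set K) (f : K -> nat) : TEN R T ->
  (forall t, f t <> 0%N -> T t /\ 0 < t) -> exists x, forall t, c x t = f t.
Proof.
move=> tT fT; have T0 : T 0 by case: tT.
have TR : T `<=` R by case: tT.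
have cut_ex (n : nat) : exists x, Pi T x /\ forall t,
    c x t = if n.+1%:R^-1 <= t then f t else 0%N.
  have n0 : 0 < n.+1%:R^-1 :> K by [].
  have /finite_seqP[s0 s0E] := TEN_locally_finite tT n0.
  pose s := rev (sort <=%O (undup s0)).
  have sE t : t \in s <-> T t /\ n.+1%:R^-1 <= t.
    rewrite mem_rev mem_sort mem_undup; split=> [ts|[Tt nt]].
      by have : [set` s0] t by []; rewrite -s0E.
    by have : (T `&` [set t | n.+1%:R^-1 <= t]) t by []; rewrite s0E.
  have ssort : pairwise (fun u v => v < u) s.
    rewrite -sorted_pairwise => [|u v w vu wv]; last exact: lt_trans vu.
    by rewrite rev_sorted sort_lt_sorted undup_uniq.
  have sT : [set` s] `|` [set 0] `<=` T by move=> t [/sE[]//|->].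
  have [|x Sx xf] := realise_finite f _ ssort.
    by move=> t /sE[/TR Rt nt]; split=> //; exact: lt_le_trans nt.
  have tS : TEN R ([set` s] `|` [set 0]).
    apply: finite_TEN; last 2 first.
    - by right.
    - by rewrite finite_setU; split; [exact: finite_seq|exact: finite_set1].
    - by move=> t /sT/TR.
  exists x; split=> [|t]; first exact: petal_mono Sx.
   have [/sE ts|ts] := pselect (T t /\ n.+1%:R^-1 <= t).
    by rewrite xf //; move/sE : ts => [_ ->].
  have -> : c x t = 0%N.
    apply: contrapT => xt; apply: ts; apply/sE.
    have [//|t0] := petal_support tS Sx xt.
    by case: xt; apply: c0; rewrite t0 ltxx => -[].
  case: ifP => // nt; apply/esym; apply: contrapT => /fT[Tt _].
  by apply: ts.
have [u uP] := choice cut_ex.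
have uT n : Pi T (u n) by case: (uP n).
have uf n t : c (u n) t = if n.+1%:R^-1 <= t then f t else 0%N by case: (uP n).
have [PU _ _ _] := X_petal; have [U SU AU] := PU _ tT.
have [||x Tx xu] := urysohn_limit SU AU (u := u) => //.
  move=> n m nm; rewrite leNgt; apply/negP => d.
  have d0 : 0 < mdist (u n) (u m) by apply: lt_trans d.
  apply: (@c_differ (u n) (u m)); first by apply/eqP; rewrite -mdist_gt0.
  rewrite !uf (ltW d) (_ : m.+1%:R^-1 <= _) //; apply: le_trans (ltW d).
  by rewrite lef_pV2 ?posrE // ler_nat.
exists x => t; have [t0|t0] := leP t 0.
  rewrite c0; last by case=> _; rewrite ltNge t0.
  by apply/esym; apply: contrapT => /fT[_]; rewrite ltNge t0.
have [n nt] := natSinv_lt t0.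
by rewrite (@c_agree x (u n)) ?uf ?(ltW nt) //; exact: le_lt_trans nt.
Qed.

(** The concatenation of two points has its support in the union of two tenuous
    sets and a singleton, which is tenuous again. *)
Lemma petal_coordinates_system : coordinate_system R c.
Proof.
split=> // x y r n Rr r0.
have [[Tx tx Txx] [Ty ty Tyy]] := (petal_of_point x, petal_of_point y).
pose f t := if r < t then c x t else if t == r then n else c y t.
have [|t ft|z zf] := @realise ((Tx `|` Ty) `|` [set r]) f.
- apply: TEN_intro.
  + by move=> t [[Tt|Tt]|->//]; [case: tx|case: ty] => + _ _; apply.
  + by left; left; case: tx.
  + move=> e e0; rewrite !setIUl !finite_setU; split; last first.
      by apply: sub_finite_set (finite_set1 r) => t [].
    by split; exact: TEN_locally_finite.
- have cpos w : c w t <> 0%N -> 0 < t.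
    by move=> wt; apply: contrapT => t0; apply: wt; apply: c0 => -[].
  move: ft; rewrite /f; case: ltP => [rt xt|_]; last case: eqP => [->|_ yt].
  + by split; [left; left; exact: petal_support xt|exact: cpos xt].
  + by split=> //; right.
  + by split; [left; right; exact: petal_support yt|exact: cpos yt].
exists z; split=> [t rt||t t0 tr]; rewrite zf /f.
- by rewrite rt.
- by rewrite ltxx eqxx.
- by rewrite ltNge (ltW tr) lt_eqF.
Qed.

End coordinates_of_centers.

Lemma petal_coordinates_exist : exists c : X -> K -> nat, coordinate_system R c.
Proof.
have ctr_ex (rx : K * X) : exists p, 0 < rx.1 ->
    center rx.1 p /\ mdist rx.2 p <= rx.1.
  have [r0|] := ltP 0 rx.1; last by exists rx.2.
  have [T tT Tx] := petal_of_point rx.2.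
  by have [p [rp _ xp]] := petal_center tT Tx r0; exists p.
have num_ex (rp : K * X) : exists g : X -> nat, R rp.1 -> 0 < rp.1 -> center rp.1 rp.2 ->
  [/\ g rp.2 = 0%N,
      forall x y, mdist rp.2 x <= rp.1 -> mdist rp.2 y <= rp.1 ->
        g x = g y <-> mdist x y < rp.1
    & forall n, exists2 x, mdist rp.2 x <= rp.1 & g x = n].
  have [[Rr [r0 rp2]]|h] := pselect (R rp.1 /\ 0 < rp.1 /\ center rp.1 rp.2).
    by have [g gP] := child_numbering Rr r0 rp2; exists g.
  by exists (fun=> 0%N) => Rr r0 rp2; case: h.
have [ctr ctrP] := choice ctr_ex; have [num numP] := choice num_ex.
exists (petal_coordinates (fun r x => ctr (r, x)) (fun r p => num (r, p))).
apply: petal_coordinates_system => [r x|r p].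
- exact: (ctrP (r, x)).
- exact: (numP (r, p)).
Qed.

End petal_coordinates.

Theorem theorem1p2 (K : realType) (R : set K)
    (hR : range_set R) (hRunc : ~ countable R)
    (X : metricType K) (hX : petaloid R X) :
  compactly_ultrahomogeneous X /\ ultrahomogeneous X.
Proof.
have [[X_ultra X_valued] [Pi X_petal]] := hX.
have [c cP] := petal_coordinates_exist hR X_ultra X_valued X_petal.
have X_compactly : compactly_ultrahomogeneous X.
  by move=> A; exact: compact_extension cP X_valued A.
by split=> // A /finite_compact; exact: X_compactly.
Qed.
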